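(* Let $n,k$ be positive integers with $n \ge 2k$, let $C>0$, and let $(A,\mathscr{A})$ be any $C$-approximate deterministic $\ell_1/\ell_1$ recovery algorithm with sparsity parameter $k$, where $A$ is an $m\times n$ real matrix. Then \[ m \;\ge\; \frac{1 - H_{\lfloor n/k\rfloor}(1/2)}{\log (4 + 2C)}\, k \log\left\lfloor\frac{n}{k}\right\rfloor . \]
   Context: A $C$-approximate deterministic $\ell_1/\ell_1$ recovery algorithm with sparsity parameter $k$ is a pair $(A,\mathscr{A})$, where $A$ is a fixed $m\times n$ real matrix and $\mathscr{A}$ is a map such that for every $x\in\mathbb{R}^n$ the output $\hat{x}=\mathscr{A}(Ax)$ satisfies $\|x-\hat{x}\|_1 \le C \min_{x'\,:\,\|x'\|_0\le k}\|x-x'\|_1$, where $\|x'\|_0$ denotes the number of nonzero entries of $x'$. For an integer $q\ge 2$, $H_q$ is the $q$-ary entropy function $H_q(x) = -x\log_q\frac{x}{q-1} - (1-x)\log_q(1-x)$. Both logarithms $\log$ in the bound are taken to the same (arbitrary) base. *)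

(* Defs.v *)
From HB Require Import structures.
From mathcomp Require Import all_boot all_order all_algebra.
From mathcomp Require Import boolp classical_sets reals exp.

Set Implicit Arguments.
Unset Strict Implicit.
Unset Printing Implicit Defensive.

Import Order.TTheory GRing.Theory Num.Theory.

Local Open Scope classical_set_scope.
Local Open Scope ring_scope.

(* The library norm on matrices is the sup norm, hence an explicit l1 norm. *)
Definition l1norm (R : realType) (n : nat) (x : 'cV[R]_n) : R :=
  \sum_(i < n) `|x i 0|.

Definition l0norm (R : realType) (n : nat) (x : 'cV[R]_n) : nat :=
  #|[set i : 'I_n | x i 0 != 0]%SET|.

(* Taken as an infimum; it is a minimum by [best_sparse_error_attained]. *)
Definition best_sparse_error (R : realType) (n k : nat) (x : 'cV[R]_n) : R :=
  inf [set l1norm (x - y) | y in [set y : 'cV[R]_n | (l0norm y <= k)%N]].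

Definition l1_recovery (R : realType) (m n k : nat) (C : R)
    (A : 'M[R]_(m, n)) (alg : 'cV[R]_m -> 'cV[R]_n) : Prop :=
  forall x : 'cV[R]_n,
    l1norm (x - alg (A *m x)) <= C * best_sparse_error k x.

Definition logb (R : realType) (b x : R) : R := ln x / ln b.

(* Intended for 2 <= q. *)
Definition entropy (R : realType) (q : nat) (x : R) : R :=
  - x * logb q%:R (x / (q%:R - 1)) - (1 - x) * logb q%:R (1 - x).

Lemma best_sparse_error_attained (R : realType) (n k : nat) (x : 'cV[R]_n) :
  exists2 y : 'cV[R]_n,
    (l0norm y <= k)%N & l1norm (x - y) = best_sparse_error k x.
Proof.
pose r (S : {set 'I_n}) : 'cV[R]_n := \col_i (if i \in S then x i 0 else 0).
have rk (S : {set 'I_n}) : (#|S| <= k)%N -> (l0norm (r S) <= k)%N.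
  apply: leq_trans; apply: subset_leq_card; apply/fintype.subsetP => i.
  by rewrite inE mxE; case: ifP => //; rewrite eqxx.
have P0 : (#|(finset.set0 : {set 'I_n})| <= k)%N by rewrite cards0.
case: (@arg_minP _ R _ finset.set0 (fun S : {set 'I_n} => (#|S| <= k)%N)
         (fun S => l1norm (x - r S)) P0) => S Sk Smin.
exists (r S); first exact: rk.
have lb : lbound [set l1norm (x - y) | y in [set y | (l0norm y <= k)%N]]
    (l1norm (x - r S)).
  move=> _ [y /= yk <-]; apply: le_trans (Smin _ yk) _.
  apply: ler_sum => i _; rewrite !mxE inE.
  by case: eqP => [->|_] /=; rewrite ?subrr ?normr0.
apply/eqP; rewrite eq_le; apply/andP; split.
- by apply: lb_le_inf lb; exists (l1norm (x - r S)), (r S); first exact: rk.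
- by apply: ge_inf; [exists (l1norm (x - r S)) | exists (r S); first exact: rk].
Qed.

(* Main.v *)
(* With q = n %/ k, a Gilbert-Varshamov code of length k over q letters, viewed
   as k-sparse 0/1 vectors of length k q <= n, gives points x_c of l1 norm k at
   mutual l1 distance >= k. Recovery forces A (x_c - x_d) = A z to imply
   k <= (1 + C) |z|, so the images are separated in the quotient norm on the
   range of A. That a set of N such points satisfies N <= (4 + 2 C)^m is usually
   a volume comparison in R^m. It is replaced here by self-similarity: the N^t
   sums x_{c_1} + l x_{c_2} + ... + l^(t-1) x_{c_t} with l = 1 / (4 + 2 C) are
   separated at scale l^t, so that a crude count of cells of a cube yields
   N^t <= c (4 + 2 C)^(m t) with c independent of t, and t tends to infinity. *)
Require Import Defs.
From mathcomp Require Import all_boot all_order all_algebra.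
From mathcomp Require Import reals.
From mathcomp Require Import exp ring lra.

Set Implicit Arguments.
Unset Strict Implicit.
Unset Printing Implicit Defensive.

Import Order.TTheory GRing.Theory Num.Theory.
Local Open Scope ring_scope.

(** * The l1 norm, separation forced by recovery, and exponential growth *)

Section L1Norm.
Variables (R : realType) (n : nat).
Implicit Types x y : 'cV[R]_n.

Lemma l1norm_ge0 x : 0 <= l1norm x.
Proof. exact: sumr_ge0. Qed.

Lemma ler_l1normD x y : l1norm (x + y) <= l1norm x + l1norm y.
Proof.
by rewrite /l1norm -big_split; apply: ler_sum => i _; rewrite mxE ler_normD.
Qed.

Lemma l1normN x : l1norm (- x) = l1norm x.
Proof. by apply: eq_bigr => i _; rewrite mxE normrN. Qed.

Lemma ler_l1normB x y : l1norm (x - y) <= l1norm x + l1norm y.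
Proof. by rewrite -(l1normN y) ler_l1normD. Qed.

Lemma l1normZ (a : R) x : l1norm (a *: x) = `|a| * l1norm x.
Proof.
by rewrite /l1norm mulr_sumr; apply: eq_bigr => i _; rewrite mxE normrM.
Qed.

Lemma ler_coord_l1norm x i : `|x i 0| <= l1norm x.
Proof. by rewrite /l1norm (bigD1 i) //= lerDl sumr_ge0. Qed.

Lemma l1norm_eq0 x : l1norm x = 0 -> x = 0.
Proof.
move=> x0; apply/matrixP => i j; rewrite ord1 mxE; apply/eqP.
by rewrite -normr_le0 -x0 ler_coord_l1norm.
Qed.

Lemma best_sparse_error_le (k : nat) x y :
  (l0norm y <= k)%N -> best_sparse_error k x <= l1norm (x - y).
Proof.
move=> yk; apply: ge_inf; last by exists y.
by exists 0 => _ [z _ <-]; exact: l1norm_ge0.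
Qed.

End L1Norm.

Lemma l1norm_mulmx_le (R : realType) (m n : nat) (G : 'M[R]_(n, m))
    (v : 'cV[R]_m) (e : R) :
  (forall j, `|v j 0| <= e) ->
  l1norm (G *m v) <= (\sum_i \sum_j `|G i j|) * e.
Proof.
move=> ve; rewrite mulr_suml; apply: ler_sum => i _; rewrite mxE mulr_suml.
apply: le_trans (ler_norm_sum _ _ _) _; apply: ler_sum => j _.
by rewrite normrM ler_wpM2l.
Qed.

(** [x] and [y + z] have the same measurements. Sparsity of [x] makes recovery exact there, while
    [y] is a sparse approximation of [y + z] with error [l1norm z]; the triangle inequality
    concludes. *)
Lemma recovery_separates (R : realType) (m n k : nat) (C : R)
    (A : 'M[R]_(m, n)) (alg : 'cV[R]_m -> 'cV[R]_n) (x y z : 'cV[R]_n) :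
  0 < C -> l1_recovery k C A alg -> (l0norm x <= k)%N -> (l0norm y <= k)%N ->
  A *m (x - y) = A *m z -> l1norm (x - y) <= (1 + C) * l1norm z.
Proof.
move=> C0 hA xk yk Axy.
have Ax : A *m x = A *m (y + z).
  by rewrite mulmxDr -Axy mulmxBr addrCA subrr addr0.
have algx : alg (A *m x) = x.
  apply/eqP; rewrite eq_sym -subr_eq0; apply/eqP/l1norm_eq0/eqP.
  rewrite eq_le l1norm_ge0 andbT; apply: le_trans (hA x) _.
  rewrite pmulr_rle0 //; apply: le_trans (best_sparse_error_le _ xk) _.
  by rewrite subrr /l1norm big1 // => i _; rewrite mxE normr0.
have := hA (y + z); rewrite -Ax algx => le1.
have le2 : l1norm (y + z - x) <= C * l1norm z.
  apply: le_trans le1 _; rewrite ler_pM2l //.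
  by apply: le_trans (best_sparse_error_le _ yk) _; rewrite addrAC subrr add0r.
have -> : x - y = z - (y + z - x).
  by apply/matrixP => i j; rewrite !mxE; ring.
by apply: le_trans (ler_l1normB _ _) _; rewrite mulrDl mul1r lerD2l.
Qed.

(** If [b < a], Bernoulli's inequality makes [(a / b) ^+ t] outgrow any constant [c]. *)
Lemma ler_exp_growth (R : realType) (a b c : R) : 0 < b ->
  (forall t, a ^+ t <= c * b ^+ t) -> a <= b.
Proof.
move=> b0 H; rewrite leNgt; apply/negP => ba.
pose r := a / b - 1.
have r0 : 0 < r by rewrite subr_gt0 ltr_pdivlMr // mul1r.
have bern t : 1 + t%:R * r <= (1 + r) ^+ t.
  elim: t => [|t IH]; first by rewrite mul0r addr0 expr0.
  rewrite exprS -natr1.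
  have : (1 + r) * (1 + t%:R * r) <= (1 + r) * (1 + r) ^+ t.
    by rewrite ler_pM2l //; lra.
  have : 0 <= t%:R * r * r by rewrite !mulr_ge0 // ltW.
  lra.
have rc t : (1 + r) ^+ t <= c.
  by rewrite /r addrC subrK expr_div_n ler_pdivrMr ?exprn_gt0.
have := le_trans (bern _) (rc (Num.truncn (c / r)).+1).
have := truncnS_gt (c / r); rewrite ltr_pdivrMr //.
lra.
Qed.

(** * Packing in the quotient norm on the range of [A] *)

Section Packing.
Variables (R : realType) (m n : nat) (A : 'M[R]_(m, n)).

(** Mutual distance at least [d] in the quotient norm, phrased over all preimages [z] to avoid an
    infimum. *)
Definition separated (U : finType) (y : U -> 'cV[R]_n) (d : R) :=
  forall u v z, u != v -> A *m (y u - y v) = A *m z -> d <= l1norm z.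

(* Partition the cube containing the images [A *m y u] into small cells: two
   images in one cell differ by [A *m z] with [l1norm z < d], because [pinvmx A]
   lifts a vector in the range of [A] to a preimage of comparable norm. *)
Lemma separated_card_le (K : R) : 0 <= K ->
  exists2 c : R, 0 <= c &
    forall (U : finType) (y : U -> 'cV[R]_n) (d : R), 0 < d ->
      (forall u, l1norm (y u) <= K) -> separated y d ->
      #|U|%:R <= (c / d + 1) ^+ m.
Proof.
move=> K0.
pose G := pinvmx A.
pose g := \sum_i \sum_j `|G i j|.
pose a := \sum_i \sum_j `|A i j|.
have g0 : 0 <= g by apply: sumr_ge0 => i _; apply: sumr_ge0.
have a0 : 0 <= a by apply: sumr_ge0 => i _; apply: sumr_ge0.
exists (2 * (a * K) * (g + 1)).
  by rewrite !mulr_ge0 // addr_ge0.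
move=> U y d d0 yK sepy.
(* The side of a cell: [g + 1] instead of [g] covers [g = 0] and makes [g * e < d] strict. *)
pose e := d / (g + 1).
have g1 : 0 < g + 1 by rewrite ltr_wpDl.
have e0 : 0 < e by rewrite divr_gt0.
pose M := a * K.
have AM u j : `|(A *m y u) j 0| <= M.
  apply: le_trans (ler_coord_l1norm _ _) _; apply: l1norm_mulmx_le => i.
  exact: le_trans (ler_coord_l1norm _ _) (yK u).
pose h u j := ((A *m y u) j 0 + M) / e.
have h0 u j : 0 <= h u j.
  have := AM u j; rewrite ler_norml => /andP[lo _].
  by apply: divr_ge0; [lra | exact: ltW].
have hM u j : h u j <= 2 * M / e.
  have := AM u j; rewrite ler_norml => /andP[_ hi].
  by rewrite ler_pM2r ?invr_gt0 //; lra.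
pose Q := Num.truncn (2 * M / e).
pose f u : {ffun 'I_m -> 'I_Q.+1} := [ffun j => inord (Num.truncn (h u j))].
have fQ u j : (Num.truncn (h u j) <= Q)%N by rewrite le_truncn.
have f_inj : injective f.
  move=> u v fuv; apply/eqP/negPn/negP => uv.
  pose z := G *m (A *m (y u - y v)).
  have Az : A *m (y u - y v) = A *m z.
    by rewrite /z (mulmxA A) (mulmxA (A *m G)) mulmxKpV.
  have := sepy _ _ _ uv Az; apply/negP; rewrite -ltNge.
  suff zg : l1norm z <= g * e.
    apply: le_lt_trans zg _; rewrite /e mulrCA gtr_pMr // ltr_pdivrMr //.
    by rewrite mul1r ltrDl.
  apply: l1norm_mulmx_le => j.
  have := congr1 (fun F : {ffun _ -> _} => val (F j)) fuv.
  rewrite !ffunE /= !inordK ?ltnS // => tr.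
  have /andP[] := truncn_itv (h0 u j); have /andP[] := truncn_itv (h0 v j).
  rewrite tr -natr1 => v1 v2 u1 u2.
  have -> : (A *m (y u - y v)) j 0 = (h u j - h v j) * e.
    rewrite -mulrBl mulfVK ?gt_eqF // mulmxBr !mxE; ring.
  rewrite normrM (gtr0_norm e0) ler_piMl ?(ltW e0) // ler_norml; lra.
have := leq_card f f_inj; rewrite card_ffun !card_ord => cardU.
rewrite -(ler_nat R) natrX in cardU; apply: le_trans cardU _.
have M0 : 0 <= 2 * M / e.
  by rewrite divr_ge0 ?(ltW e0) // mulr_ge0 // mulr_ge0.
apply: lerXn2r; rewrite ?nnegrE //.
- by rewrite addr_ge0 // divr_ge0 ?(ltW d0) // !mulr_ge0 // ltW.
- have -> : 2 * (a * K) * (g + 1) / d = 2 * M / e.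
    by rewrite /e invf_div [2 * M * _]mulrA.
  by rewrite -natr1 lerD2r; have /andP[] := truncn_itv M0.
Qed.

(* The points [y] are the sums [x s_1 + l x s_2 + ... + l^(t-1) x s_t]: the
   first index at which two of them differ dominates all the later ones. *)
Lemma separated_iter (T : finType) (x : T -> 'cV[R]_n) (K d l : R) (t : nat) :
  0 < l < 1 -> 0 <= K -> (forall s, l1norm (x s) <= (1 - l) * K) ->
  separated x (d + 2 * l * K) -> 0 <= d ->
  exists (U : finType) (y : U -> 'cV[R]_n),
    [/\ #|U| = (#|T| ^ t)%N, forall u, l1norm (y u) <= K
      & separated y (d * l ^+ t)].
Proof.
move=> /andP[l0 l1] K0 xK sepx d0; elim: t => [|t [U [y [cardU yK sepy]]]].
  exists unit, (fun=> 0); split; first by rewrite card_unit.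
    by move=> _; rewrite /l1norm big1 // => i _; rewrite mxE normr0.
  by case=> [] [].
exists (T * U)%type, (fun p => x p.1 + l *: y p.2); split.
- by rewrite card_prod cardU expnS.
- case=> s u /=; apply: le_trans (ler_l1normD _ _) _.
  rewrite l1normZ (gtr0_norm l0).
  have := xK s; have : l * l1norm (y u) <= l * K by rewrite ler_pM2l.
  lra.
case=> s u [s' u'] z /= neq Az.
have [ss|ss] := eqVneq s s'.
  have uu : u != u' by apply: contra neq => /eqP ->; rewrite ss.
  (* Equal leading terms cancel; dividing by [l] reduces to the induction hypothesis. *)
  have /(sepy _ _ _ uu) : A *m (y u - y u') = A *m (l^-1 *: z).
    rewrite -scalemxAr -Az ss opprD addrACA subrr add0r -scalerBr -scalemxAr.
    by rewrite scalerA mulVf ?gt_eqF // scale1r.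
  rewrite l1normZ gtr0_norm ?invr_gt0 // ler_pdivlMl // => le.
  by apply: le_trans le; rewrite exprS mulrCA.
(* Distinct leading terms: moving the tails into the preimage costs at most [2 * l * K]. *)
have /(sepx _ _ _ ss) : A *m (x s - x s') = A *m (z - l *: (y u - y u')).
  rewrite [RHS]mulmxBr -Az -mulmxBr; congr mulmx.
  by apply/matrixP => i j; rewrite !mxE; ring.
have := ler_l1normB z (l *: (y u - y u')).
rewrite l1normZ (gtr0_norm l0).
have : l * l1norm (y u - y u') <= l * (K + K).
  by rewrite ler_pM2l //; apply: le_trans (ler_l1normB _ _) (lerD _ _).
have : d * l ^+ t.+1 <= d by rewrite ler_piMr // exprn_ile1 // ltW.
lra.
Qed.

Lemma packing (T : finType) (x : T -> 'cV[R]_n) (K D L : R) :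
  1 < L -> 0 <= K -> (forall s, l1norm (x s) <= K) -> separated x D ->
  2 * K / (L - 1) < D -> #|T|%:R <= L ^+ m.
Proof.
move=> L1 K0 xK sepx KD.
have L0 : 0 < L by lra.
have LB : 0 < L - 1 by lra.
have l01 : 0 < L^-1 < 1 by rewrite invr_gt0 L0 /= invf_lt1.
(* The geometric series bound [K / (1 - L^-1)]. Then [2 * L^-1 * K'] is [2 * K / (L - 1)], so [KD]
   makes [d] below positive. *)
pose K' := K * L / (L - 1).
have K'0 : 0 <= K' by rewrite divr_ge0 ?mulr_ge0 ?(ltW L0) ?(ltW LB).
pose d := D - 2 * K / (L - 1).
have d0 : 0 < d by rewrite subr_gt0.
have [c c0 Hc] := separated_card_le K'0.
have x' s : l1norm (x s) <= (1 - L^-1) * K'.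
  rewrite (_ : _ * K' = K) // /K'; field; lra.
have sep' : separated x (d + 2 * L^-1 * K').
  rewrite (_ : d + _ = D) // /d /K'; field; lra.
apply: (@ler_exp_growth _ _ _ ((c / d + 1) ^+ m)); first by rewrite exprn_gt0.
move=> t.
have [U [y [cardU yK sepy]]] := separated_iter t l01 K'0 x' sep' (ltW d0).
have lt0 : 0 < L^-1 ^+ t by rewrite exprn_gt0 // invr_gt0.
have := Hc U y _ (mulr_gt0 d0 lt0) yK sepy.
rewrite cardU natrX => le; apply: le_trans le _.
rewrite -!exprM mulnC exprM -exprMn; apply: lerXn2r; rewrite ?nnegrE.
- by rewrite addr_ge0 // divr_ge0 // ltW // mulr_gt0.
- by rewrite mulr_ge0 ?exprn_ge0 ?(ltW L0) // addr_ge0 // divr_ge0 // ltW.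
(* The additive 1 is absorbed because [1 <= L ^+ t]. *)
rewrite [leRHS]mulrDl mul1r exprVn invfM invrK mulrA lerD2l.
by rewrite exprn_ege1 // ltW.
Qed.

End Packing.

(** * Codes in the Hamming metric and their sparse vectors *)

Section Code.
Variables (R : realType) (k q : nat).
Notation word := {ffun 'I_k -> 'I_q}.

Definition hamming (c d : word) : nat := \sum_i (c i != d i).

(** The sum factors over positions; at each, the letter of [c] weighs 1 and the [q.-1] others weigh
    [w]. *)
Lemma hamming_weight_sum (w : R) (c : word) :
  \sum_(d : word) w ^+ hamming c d = (1 + w * q.-1%:R) ^+ k.
Proof.
transitivity (\sum_(d : word) \prod_i (w ^+ (c i != d i))).
  by apply: eq_bigr => d _; rewrite /hamming expr_sum.
rewrite -(bigA_distr_bigA (fun i a => w ^+ (c i != a))) /=.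
rewrite (eq_bigr (fun=> 1 + w * q.-1%:R)) ?prodr_const ?card_ord // => i _.
rewrite (bigD1 (c i)) //= eqxx expr0; congr (_ + _).
rewrite (eq_bigr (fun=> w)); last by move=> a; rewrite eq_sym => ->.
by rewrite sumr_const cardC1 card_ord mulr_natr.
Qed.

(* Gilbert-Varshamov: every word is within distance [k/2] of a maximal code,
   so it contributes at least [u ^ k] to the sum of the
   [u ^ (2 * hamming c d)] over all codewords [c] and words [d]. *)
Lemma gilbert_varshamov (u : R) : 0 < u <= 1 -> u ^+ 2 * q.-1%:R = 1 ->
  exists S : {set word},
    {in S &, forall c d, c != d -> (k <= 2 * hamming c d)%N} /\
    (q%:R * u) ^+ k <= #|S|%:R * 2 ^+ k.
Proof.
move=> /andP[u0 u1] uq.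
pose P (S : {set word}) :=
  [forall c in S, forall d in S, (c != d) ==> (k <= 2 * hamming c d)%N].
have P0 : P set0 by apply/forall_inP => c; rewrite inE.
have [S maxS _] := maxset_exists P0.
have PS := maxsetp maxS.
have sepS : {in S &, forall c d, c != d -> (k <= 2 * hamming c d)%N}.
  move=> c d cS dS.
  by move/forall_inP: PS => /(_ c cS)/forall_inP/(_ d dS)/implyP.
have hammC c d : hamming c d = hamming d c.
  by apply: eq_bigr => i _; rewrite eq_sym.
exists S; split => //.
(* Otherwise [d] could be added to [S], against maximality. *)
have cover d : exists2 c, c \in S & (2 * hamming c d <= k)%N.
  apply/exists_inP; apply: contraT; rewrite negb_exists_in => /forall_inP far.
  have dS : d \notin S.
    by apply/negP => /far; rewrite /hamming big1 // => i _; rewrite eqxx.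
  have PdS : P (d |: S).
    apply/forall_inP => a /setU1P aS; apply/forall_inP => b /setU1P bS.
    apply/implyP; case: aS bS => [->|aS] [->|bS] ab.
    - by rewrite eqxx in ab.
    - by rewrite hammC; apply: ltnW; rewrite ltnNge far.
    - by apply: ltnW; rewrite ltnNge far.
    - exact: sepS.
  have := maxsetsup maxS PdS (subsetUr _ _) => E.
  by move: dS; rewrite -E setU11.
have -> : (q%:R * u) ^+ k = \sum_(d : word) u ^+ k.
  by rewrite sumr_const card_ffun !card_ord exprMn -natrX mulr_natl.
apply: (@le_trans _ _ (\sum_(d : word) \sum_(c in S) (u ^+ 2) ^+ hamming c d)).
  apply: ler_sum => d _; have [c cS cd] := cover d.
  rewrite (bigD1 c) //= -[u ^+ k]addr0; apply: lerD.
    by rewrite -exprM; apply: ler_wiXn2l => //; exact: ltW.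
  by apply: sumr_ge0 => e _; rewrite !exprn_ge0 // ltW.
(* By [uq], each factor [1 + u ^+ 2 * q.-1%:R] is 2. *)
rewrite exchange_big /= (eq_bigr (fun=> 2 ^+ k)); last first.
  by move=> c _; rewrite hamming_weight_sum uq.
by rewrite sumr_const mulr_natl.
Qed.

Variables (n : nat) (e : 'I_k * 'I_q -> 'I_n).

(** One-hot encoding of each letter in its own block of [q] coordinates, laid out by [e]. *)
Definition graph_vec (c : word) : 'cV[R]_n :=
  \col_l (l \in [set e (i, c i) | i : 'I_k])%:R.

Lemma l0norm_graph_vec (c : word) : (l0norm (graph_vec c) <= k)%N.
Proof.
apply: leq_trans (_ : #|[set e (i, c i) | i : 'I_k]| <= k)%N; last first.
  by apply: leq_trans (leq_imset_card _ _) _; rewrite card_ord.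
apply: subset_leq_card; apply/subsetP => l; rewrite inE mxE.
by case: (l \in _) => //; rewrite eqxx.
Qed.

Lemma l1norm_graph_vec (c : word) : l1norm (graph_vec c) <= k%:R.
Proof.
have -> : l1norm (graph_vec c) = (l0norm (graph_vec c))%:R.
  rewrite /l0norm -sum1_card natr_sum big_mkcond; apply: eq_bigr => l _.
  rewrite inE mxE; case: (l \in _); first by rewrite oner_eq0 normr1.
  by rewrite eqxx normr0.
by rewrite ler_nat l0norm_graph_vec.
Qed.

(** Each position [i] where the words differ yields two distinct coordinates, [e (i, c i)] and
    [e (i, d i)], with entries 1 and -1. *)
Lemma l1norm_graph_vecB (c d : word) : injective e ->
  (2 * hamming c d)%:R <= l1norm (graph_vec c - graph_vec d).
Proof.
move=> e_inj.
have graphE b i a : graph_vec b (e (i, a)) 0 = (b i == a)%:R.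
  rewrite mxE; congr (_ %:R); congr nat_of_bool.
  apply/imsetP/eqP => [[j _ /e_inj[-> ->]]|<-] //.
  by exists i.
have diffE i a : (graph_vec c - graph_vec d) (e (i, a)) 0 =
    (c i == a)%:R - (d i == a)%:R.
  by rewrite -!graphE !mxE.
apply: (@le_trans _ _
    (\sum_(l in e @: setT) `|(graph_vec c - graph_vec d) l 0|)).
  rewrite big_imset /=; last by move=> p p' _ _ /e_inj.
  rewrite (eq_bigl predT); last by move=> p; rewrite inE.
  pose F i a := `|(graph_vec c - graph_vec d) (e (i, a)) 0|.
  rewrite (eq_bigr (fun p => F p.1 p.2)); last by case.
  rewrite -(pair_bigA _ F) /= /F.
  rewrite big_distrr natr_sum; apply: ler_sum => i _ /=.
  have [cd|cd] := eqVneq (c i) (d i); first by rewrite sumr_ge0.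
  rewrite (bigD1 (c i)) //= (bigD1 (d i)) 1?eq_sym //= [_ *+ 2]mulr2n addrA.
  rewrite !diffE !eqxx (negbTE cd) [d i == c i]eq_sym (negbTE cd).
  rewrite subr0 sub0r normrN normr1.
  by rewrite lerDl sumr_ge0.
by rewrite /l1norm [leRHS](bigID (mem (e @: setT))) /= lerDl sumr_ge0.
Qed.

End Code.

(** * Entropy at one half and the final bound *)

(** The right-hand side is the logarithm of [q / (2 * sqrt (q - 1))], the base of the code size
    bound. *)
Lemma entropy_half (R : realType) (q : nat) : (1 < q)%N ->
  (1 - entropy q (1 / 2 : R)) * ln q%:R =
    ln q%:R - (ln q.-1%:R / 2 + ln 2).
Proof.
move=> q1.
have lnq : ln (q%:R : R) != 0 by rewrite gt_eqF // ln_gt0 // ltr1n.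
have qp : (0 < q.-1)%N by rewrite -ltnS prednK // ltnW.
rewrite /entropy /logb -(natrB _ (ltnW q1)) subn1.
have -> : 1 - 1 / 2 = 2^-1 :> R by field.
rewrite mul1r ln_div ?posrE ?invr_gt0 ?ltr0n // lnV ?posrE //.
by field.
Qed.

Lemma sparse_recovery_code_bound (R : realType) (m n k q : nat) (C : R)
    (A : 'M[R]_(m, n)) (alg : 'cV[R]_m -> 'cV[R]_n) :
  (0 < k)%N -> (1 < q)%N -> (k * q <= n)%N -> 0 < C -> l1_recovery k C A alg ->
  (q%:R / Num.sqrt q.-1%:R) ^+ k <= (4 + 2 * C) ^+ m * 2 ^+ k.
Proof.
move=> k0 q1 kqn C0 hA.
have qp : (0 < q.-1)%N by rewrite -ltnS prednK // ltnW.
(* [r^-1] is the positive [u] with [u ^+ 2 * q.-1%:R = 1]; [1 < q] gives [u <= 1]. *)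
pose r : R := Num.sqrt q.-1%:R.
have r0 : 0 < r by rewrite sqrtr_gt0 ltr0n.
have r1 : 1 <= r by rewrite -[1]sqrtr1 ler_sqrt ?ler1n.
have u01 : 0 < r^-1 <= 1 by rewrite invr_gt0 r0 /= invf_le1.
have uq : r^-1 ^+ 2 * q.-1%:R = 1.
  by rewrite exprVn sqr_sqrtr // mulVf // gt_eqF // ltr0n.
have [S [sepS cardS]] := @gilbert_varshamov R k q _ u01 uq.
apply: le_trans cardS _; rewrite ler_pM2r ?exprn_gt0 //.
have kq : (#|{: 'I_k * 'I_q}| <= n)%N by rewrite card_prod !card_ord.
pose e (p : 'I_k * 'I_q) : 'I_n := widen_ord kq (enum_rank p).
have e_inj : injective e.
  by move=> p p' /(congr1 val) /= /val_inj /enum_rank_inj.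
pose x (c : {c | c \in S}) : 'cV[R]_n := graph_vec R e (val c).
rewrite -card_sig; apply: (@packing _ _ _ A _ x k%:R (k%:R / (1 + C))).
- lra.
- by [].
- by move=> c; exact: l1norm_graph_vec.
- move=> c d z cd Az.
  have := recovery_separates C0 hA (l0norm_graph_vec _ _ _)
    (l0norm_graph_vec _ _ _) Az.
  rewrite ler_pdivrMr; last lra.
  rewrite [l1norm z * _]mulrC; apply: le_trans.
  apply: le_trans (l1norm_graph_vecB _ _ _ e_inj).
  by rewrite ler_nat sepS ?(valP c) ?(valP d).
(* The choice [L = 4 + 2 * C] gives [2k / (3 + 2C) < 2k / (2 + 2C) = k / (1 + C)]. *)
- have kR : 0 < k%:R :> R by rewrite ltr0n.
  rewrite ltr_pdivrMr; last lra.
  rewrite mulrAC ltr_pdivlMr; last lra.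
  have : 0 < k%:R * (3 + 2 * C) - k%:R * (2 + 2 * C).
    by rewrite -mulrBr mulr_gt0 //; lra.
  lra.
Qed.

Theorem theorem3 (R : realType) (m n k : nat) (C b : R)
    (A : 'M[R]_(m, n)) (alg : 'cV[R]_m -> 'cV[R]_n)
    (hk : (0 < k)%N) (hn : (2 * k <= n)%N) (hC : 0 < C)
    (hb : 0 < b) (hb1 : b != 1)
    (hA : l1_recovery k C A alg) :
  (1 - entropy (n %/ k) (1 / 2 : R)) / logb b (4 + 2 * C)
    * k%:R * logb b (n %/ k)%:R <= m%:R.
Proof.
have q1 : (1 < n %/ k)%N by rewrite leq_divRL.
have kqn : (k * (n %/ k) <= n)%N by rewrite mulnC leq_trunc_div.
have := sparse_recovery_code_bound hk q1 kqn hC hA.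
move: (n %/ k)%N q1 {kqn} => q q1.
have qp : (0 < q.-1)%N by rewrite -ltnS prednK // ltnW.
have q0 : 0 < q%:R :> R by rewrite ltr0n ltnW.
have r0 : 0 < Num.sqrt q.-1%:R :> R by rewrite sqrtr_gt0 ltr0n.
have L1 : 1 < 4 + 2 * C by lra.
have L0 : 0 < 4 + 2 * C by lra.
rewrite -ler_ln ?posrE ?mulr_gt0 ?exprn_gt0 ?divr_gt0 //.
rewrite lnM ?posrE ?exprn_gt0 // !lnXn ?divr_gt0 // ln_div ?posrE //.
have -> : ln (Num.sqrt q.-1%:R) = ln q.-1%:R / 2 :> R.
  rewrite -[in RHS](@sqr_sqrtr R q.-1%:R) // lnXn //.
  by rewrite -[_ *+ 2]mulr_natr; field.
rewrite -[_ *+ k in leLHS]mulr_natr -[_ *+ m]mulr_natr -[_ *+ k]mulr_natr => bound.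
(* The factor [ln b] of the two logarithms cancels, whatever its sign. *)
have lnb : ln b != 0 by rewrite ln_eq0.
have lnL : 0 < ln (4 + 2 * C) by rewrite ln_gt0.
rewrite [leLHS](_ : _ =
    (1 - entropy q (1 / 2 : R)) * ln q%:R * k%:R / ln (4 + 2 * C)); last first.
  by rewrite /logb; field; rewrite lnb gt_eqF.
rewrite ler_pdivrMr // entropy_half //.
lra.
Qed.
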